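(* Consider the two-dimensional problem (NLP$_2$): maximize $f(x_1,x_2)$ subject to $g_i(x_1,x_2)\le 0$ for $i=1,\dots,m$, $(x_1,x_2)\in\mathbb{R}^2$, with feasible set $F$. Assume $f$ is a concave real analytic function, the $g_i$ are twice continuously differentiable, $F$ is connected and bounded, and LICQ holds at all points of $\partial F$. If (NLP$_2$) is boundary-invex, then it is KT-invex.
   Context: LICQ at $\vec x$: the gradients $\nabla g_i(\vec x)$ of the constraints active at $\vec x$ (those with $g_i(\vec x)=0$) are linearly independent. A point $\vec x^*\in F$ is a KKT point of (NLP$_2$) if there are $\mu_1,\dots,\mu_m\ge 0$ with $\nabla f(\vec x^* )=\sum_i\mu_i\nabla g_i(\vec x^* )$ and $\mu_i g_i(\vec x^* )=0$ for all $i$. (NLP$_2$) is KT-invex if every KKT point is a global optimizer (global maximizer of $f$ on $F$). For each non-convex constraint $g_i\le 0$ ($g_i$ not a convex function), let (NLP$_{2i}$) be the problem: minimize $f(x_1,x_2)$ subject to $g_i(x_1,x_2)\ge 0$. Its KKT points are the points $\vec x^*$ with $g_i(\vec x^* )\ge 0$ for which there is $\mu\ge 0$ with $\nabla f(\vec x^* )=\mu\nabla g_i(\vec x^* )$ and $\mu g_i(\vec x^* )=0$. Let (NLP$_i$) be the problem: minimize $f$ subject to $g_i=0$; the KKT multiplier of $\vec x^*$ in (NLP$_i$) is the real number $\lambda$ with $\nabla f(\vec x^* )=-\lambda\nabla g_i(\vec x^* )$. (NLP$_2$) is boundary-invex if, for each non-convex constraint $g_i\le 0$, at least one of the following holds for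 every KKT point $\vec x^*$ of (NLP$_{2i}$): (1) $\vec x^*$ is infeasible for (NLP$_2$); (2) $\vec x^*$ has a non-negative KKT multiplier in (NLP$_i$); (3) $\vec x^*$ is a local maximum with respect to (NLP$_2$), i.e. $\vec x^*\in F$ and $f(\vec x)\le f(\vec x^* )$ for all $\vec x\in F$ in some neighborhood of $\vec x^*$. *)

(* Defs.v *)
(* The plane is 'rV[R]_2, whose library norm is the sup norm (same topology and
   bounded sets as the Euclidean one). *)
From HB Require Import structures.
From mathcomp Require Import all_boot all_order all_algebra.
From mathcomp Require Import all_classical all_reals all_analysis.

Set Implicit Arguments.
Unset Strict Implicit.
Unset Printing Implicit Defensive.

Import Order.TTheory GRing.Theory Num.Theory.
Import numFieldNormedType.Exports.

Local Open Scope classical_set_scope.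
Local Open Scope ring_scope.

Section Functions.
Context {R : realType}.
Implicit Types (h : 'rV[R]_2 -> R) (p x v : 'rV[R]_2).

Definition grad h x : 'rV[R]_2 := \row_j 'D_(delta_mx 0 j) h x.

(* [jacobian (grad h) x] is the Hessian matrix of [h] at [x]. *)
Definition twice_continuously_differentiable h : Prop :=
  [/\ forall x, differentiable h x,
      forall x, differentiable (grad h) x
    & continuous (fun x => jacobian (grad h) x)].

Definition power_term (c : nat * nat -> R) v (jk : nat * nat) : R :=
  c jk * v 0 0 ^+ jk.1 * v 0 1 ^+ jk.2.

(* Convergence of the double series means absolute convergence; its sum is
   then the limit of the square partial sums. *)
Definition real_analytic h : Prop :=
  forall p, exists (c : nat * nat -> R) (r : R), 0 < r /\
    forall v, `|v| < r ->
      summable [set: nat * nat] (fun jk => (power_term c v jk)%:E) /\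
      (fun n : nat => \sum_(j < n) \sum_(k < n)
         power_term c v (val j, val k)) @ \oo --> h (p + v).

Definition convex_on_plane h : Prop := convex_function [set: 'rV[R]_2] h.

Definition concave_on_plane h : Prop := convex_on_plane (fun x => - h x).

End Functions.

Definition boundary {T : topologicalType} (A : set T) : set T :=
  closure A `\` interior A.

Section Problem.
Context {R : realType} {m : nat}.
Variables (f : 'rV[R]_2 -> R) (g : 'I_m -> 'rV[R]_2 -> R).
Implicit Type x : 'rV[R]_2.

Definition feasible : set 'rV[R]_2 := [set x | forall i, g i x <= 0].

(* [free] is applied to the indexed family, so that two active constraints
   with equal gradients violate the condition. *)
Definition LICQ x : Prop :=
  free [seq grad (g i) x | i <- enum 'I_m & g i x == 0].

Definition KKT_point x : Prop :=
  feasible x /\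
  exists mu : 'I_m -> R,
    [/\ forall i, 0 <= mu i,
        grad f x = \sum_i mu i *: grad (g i) x
      & forall i, mu i * g i x = 0].

Definition global_maximizer x : Prop :=
  feasible x /\ forall y, feasible y -> f y <= f x.

Definition local_maximum x : Prop :=
  feasible x /\ \forall y \near x, feasible y -> f y <= f x.

Definition KT_invex : Prop := forall x, KKT_point x -> global_maximizer x.

(* KKT points of: minimize [f] subject to [g i >= 0]. *)
Definition reversed_KKT_point (i : 'I_m) x : Prop :=
  0 <= g i x /\
  exists mu : R,
    [/\ 0 <= mu, grad f x = mu *: grad (g i) x & mu * g i x = 0].

(* KKT multipliers of [x] in: minimize [f] subject to [g i = 0]. *)
Definition equality_KKT_multiplier (i : 'I_m) x (lambda : R) : Prop :=
  grad f x = - lambda *: grad (g i) x.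

Definition boundary_invex : Prop :=
  forall i : 'I_m, ~ convex_on_plane (g i) ->
  forall x, reversed_KKT_point i x ->
    [\/ ~ feasible x,
        exists lambda : R, 0 <= lambda /\ equality_KKT_multiplier i x lambda
      | local_maximum x].

End Problem.

(* Main.v *)
(* If the gradient of [f] vanishes at a KKT point, concavity makes the point a
   global maximizer. Otherwise LICQ leaves one or two positive multipliers: two
   of them make the point a local maximum, and a single one does too, either by
   convexity of the constraint or by boundary-invexity. So every KKT point is a
   local maximum, and a mountain-pass argument concludes. Suppose a local maximum
   [x] is not global, let [f y > f x], and let [c] be the highest level such
   that [x] and [y] are connected in [f >= t] for all [t < c]. At the points of
   level [c] that are not local maxima, hence not KKT, LICQ gives a direction
   pointing into the feasible set along which [f] increases; pushing along it
   joins the nearby points of higher level above [c]. Hence [x] and [y] are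
   either connected above [c], or separated at level [c] and then, by
   compactness, slightly below [c]; both contradict the choice of [c]. *)
Require Import Defs.
From HB Require Import structures.
From mathcomp Require Import all_boot all_order all_algebra.
From mathcomp Require Import all_classical all_reals all_analysis.
From mathcomp Require Import ring lra.
Import Order.TTheory GRing.Theory Num.Theory.
Import numFieldNormedType.Exports.
Local Open Scope classical_set_scope.
Local Open Scope ring_scope.

Set Implicit Arguments.
Unset Strict Implicit.
Unset Printing Implicit Defensive.

(** * Minimax over superlevel sets *)

Definition superlevel {R : realType} {T : Type} (F : set T) (f : T -> R) (t : R) : set T :=
  F `&` [set z | t <= f z].

(** For [F] the feasible set this unfolds to [local_maximum]; the general form keeps the minimax
    argument independent of the plane. *)
Definition local_max_on {R : realType} {T : topologicalType} (F : set T) (f : T -> R) (p : T) :=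
  F p /\ \forall q \near p, F q -> f q <= f p.

Section MinimaxSeparation.
Context {R : realType} {T : pseudoMetricType R}.
Variables (F : set T) (f : T -> R).
Hypotheses (F_compact : compact F) (F_closed : closed F) (F_connected : connected F).
Hypothesis f_cont : continuous f.

Lemma continuous_near_gt (t : R) (p : T) : t < f p -> \forall q \near p, t < f q.
Proof. by move=> tp; exact: (cvgr_gt (f p) (@f_cont p) t tp). Qed.

Lemma superlevel_sub (s t : R) : s <= t -> superlevel F f t `<=` superlevel F f s.
Proof. by move=> st z [Fz tz]; split => //; exact: le_trans tz. Qed.

Lemma connected_component_sub_set (A B : set T) (p q : T) :
  A `<=` B -> connected_component A p q -> connected_component B p q.
Proof.
move=> AB [C [Cp CA Cc] Cq]; exists C => //; split => //.
exact: subset_trans AB.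
Qed.

(** A clopen piece of [f >= c] stays separated slightly below [c]: normality puts [E] and the rest
    of [f >= c] into disjoint open sets [U] and [V], and on the compact set of points of [F] outside
    both, the maximum of [f] is less than [c]. *)
Lemma clopen_superlevel_lower (c : R) (E : set T) (x y : T) :
  E `<=` superlevel F f c ->
  (forall p, E p -> \forall q \near p, superlevel F f c q -> E q) ->
  (forall p, superlevel F f c p -> ~ E p ->
     \forall q \near p, superlevel F f c q -> ~ E q) ->
  E x -> superlevel F f c y -> ~ E y ->
  exists2 t, t < c & forall s, t < s -> ~ connected_component (superlevel F f s) x y.
Proof.
move=> EF Eo Eco Ex Fcy nEy.
have Fc_closed : closed (superlevel F f c).
  apply: closedI => //.
  rewrite [X in closed X](_ : _ = f @^-1` [set z | c <= z]) //.
  by apply: preimage_closed => [? _|]; [exact: f_cont | exact: closed_ge].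
pose K1 := E; pose K2 := superlevel F f c `\` E.
have K1c : closed K1.
  move=> p clp.
  have Fp : superlevel F f c p by apply: Fc_closed; apply: (closureS EF).
  apply: contrapT => nEp.
  have [q [Eq]] := clp _ (Eco _ Fp nEp).
  by move=> /(_ (EF _ Eq)).
have K2c : closed K2.
  move=> p clp.
  have Fp : superlevel F f c p by apply: Fc_closed; apply: (closureS (@subDsetl _ _ _)) clp.
  split => // Ep.
  have [q [[Fq nEq]]] := clp _ (Eo _ Ep).
  by move=> /(_ Fq).
have K12 : K1 `&` K2 = set0 by rewrite /K1 /K2 setDE setIA setIC setIA setICl set0I.
have := @pseudometric_normal R T => /(@normal_openP R) /(_ K1 K2 K1c K2c K12).
move=> [U [V [Uo Vo K1U K2V UV]]].
have Rem_compact : compact (F `\` (U `|` V)).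
  rewrite setDE; apply: compact_closedI => //.
  by rewrite closedC; exact: openU.
have Rem_lt z : (F `\` (U `|` V)) z -> f z < c.
  move=> [Fz nUV]; rewrite ltNge; apply/negP => cz.
  apply: nUV; have [Ez|nEz] := pselect (E z); first by left; exact: K1U.
  by right; apply: K2V.
have [t tc tR] : exists2 t, t < c & forall z, (F `\` (U `|` V)) z -> f z <= t.
  have [e|/set0P ne] := eqVneq (F `\` (U `|` V)) set0.
    by exists (c - 1); [rewrite ltrBlDr ltrDl|rewrite e].
  have [z Rz zmax] := compact_EVT_max ne Rem_compact (continuous_subspaceT f_cont).
  exists (f z); first by apply: Rem_lt; rewrite inE in Rz.
  by move=> w Rw; apply: zmax; rewrite inE.
exists t => // s ts [C [Cx CF Cc] Cy].
have CUV : C `<=` U `|` V.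
  move=> z Cz; apply: contrapT => nUV.
  have [Fz sz] := CF z Cz.
  have := tR z (conj Fz nUV).
  by rewrite leNgt (lt_le_trans ts).
(* Since [C] is covered by the disjoint open sets [U] and [V], its trace on [U] is open and closed
   in [C]. *)
have : C `&` U = C.
  apply: Cc.
  - by exists x; split => //; exact: K1U.
  - by exists U.
  - exists (~` V); first by rewrite closedC.
    apply/seteqP; split => z [Cz] Hz; split => //.
      by move=> Vz; have : (U `&` V) z by []; rewrite UV.
    by have [] := CUV z Cz.
move=> e; have : (C `&` U) y by rewrite e.
move=> [_ Uy]; have : (U `&` V) y by split => //; exact: K2V.
by rewrite UV.
Qed.

(* With [c] the supremum of the levels [t] at which [x] and [y] are joined inside
   [f >= t], the points of level at least [c] all of whose
   close neighbours of level above [c] are joined to [x] above [c] form a clopen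
   piece of [f >= c] that contains [x] but not [y]. *)
Lemma local_max_on_global :
  (forall p t, F p -> t < f p ->
     \forall q \near p, F q -> connected_component (superlevel F f t) p q) ->
  (forall p, F p -> local_max_on F f p \/
     exists U, [/\ nbhs p U, forall q, U q -> ~ local_max_on F f q &
       forall q q', U q -> U q' -> F q -> F q' -> f p < f q -> f p < f q' ->
         exists2 t, f p < t & connected_component (superlevel F f t) q q']) ->
  forall x, local_max_on F f x -> forall y, F y -> f y <= f x.
Proof.
move=> loc reg x [Fx xmax] y Fy; rewrite leNgt; apply/negP => xy.
pose S := [set t | connected_component (superlevel F f t) x y].
have S_ub t : S t -> t <= f x.
  by move=> [C [Cx CF _] _]; have [] := CF _ Cx.
have S_ne : S !=set0.
  have F0 : F !=set0 by exists x.
  have [z Fz zmin] := compact_EVT_min F0 F_compact (continuous_subspaceT f_cont).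
  exists (f z); exists F => //; split => // w Fw; split => //.
  by apply: zmin; rewrite inE.
have S_sup : has_sup S by split => //; exists (f x) => t; exact: S_ub.
pose c := sup S.
have cx : c <= f x by apply: ge_sup => // t; exact: S_ub.
have cy : c < f y by exact: le_lt_trans cx xy.
pose sim q := exists2 t, c < t & connected_component (superlevel F f t) q x.
have nsim_y : ~ sim y.
  move=> [t ct /connected_component_sym tyx].
  have : t <= c by apply: ub_le_sup; [case: S_sup|].
  by rewrite leNgt ct.
have sim_trans t p q : c < t -> connected_component (superlevel F f t) p q -> sim q -> sim p.
  move=> ct pq [s cs qx]; exists (Num.min s t); first by rewrite lt_min cs.
  apply: (@connected_component_trans _ _ q).
    by apply: connected_component_sub_set pq; apply: superlevel_sub; rewrite ge_min lexx orbT.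
  by apply: connected_component_sub_set qx; apply: superlevel_sub; rewrite ge_min lexx.
pose E := [set p | superlevel F f c p /\ \forall q \near p, F q -> c < f q -> sim q].
(* The midpoint of [c] and [f p] is a level above [c] at which [p] is joined to all its close
   neighbours in [F]. *)
have loc_c p : F p -> c < f p ->
    \forall q \near p, F q -> (sim p -> sim q) /\ (sim q -> sim p).
  move=> Fp cp.
  have [cm mp] : c < (c + f p) / 2 /\ (c + f p) / 2 < f p by rewrite !midf_lt.
  near=> q => Fq.
  have pq : connected_component (superlevel F f ((c + f p) / 2)) p q.
    by move: Fq; near: q; exact: loc.
  split; first by apply: (sim_trans _ _ _ cm); exact: connected_component_sym.
  exact: (sim_trans _ _ _ cm).
(* If [f x > c], close neighbours are joined to [x] above [c]; if [f x = c], local maximality leaves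
   no close neighbour above [c]. *)
have Ex : E x.
  split => //; have [cfx|xc] := ltP c (f x); last first.
    near=> q => Fq cq; have qx : f q <= f x by move: Fq; near: q; exact: xmax.
    by have := lt_le_trans cq (le_trans qx xc); rewrite ltxx.
  near=> q => Fq _.
  have [] : (sim x -> sim q) /\ (sim q -> sim x) by move: Fq; near: q; exact: loc_c.
  move=> + _; apply.
  by exists (f x) => //; apply: connected_component_refl; split => /=.
have nEy : ~ E y by move=> [_ /nbhs_singleton] /(_ Fy cy).
have [t tc tno] : exists2 t, t < c &
    forall s, t < s -> ~ connected_component (superlevel F f s) x y.
  apply: (@clopen_superlevel_lower c E) => //.
  - by move=> p [].
  - move=> p [_ /nbhs_interior Ep]; near=> q => Fq; split => //.
    exact: (near Ep q).
  - move=> p [Fp]; rewrite /= le_eqVlt => /predU1P[cp nEp|cp nEp]; last first.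
      have nsim_p : ~ sim p.
        move=> simp; apply: nEp; split; first by split => //; exact: ltW.
        near=> q => Fq _.
        have [] : (sim p -> sim q) /\ (sim q -> sim p) by move: Fq; near: q; exact: loc_c.
        by move=> + _; exact.
      near=> q => Fcq [_ /nbhs_singleton].
      have Fq : F q by case: Fcq.
      have cq : c < f q by near: q; exact: continuous_near_gt.
      move=> /(_ Fq cq).
      have [] : (sim p -> sim q) /\ (sim q -> sim p) by move: Fq; near: q; exact: loc_c.
      by move=> _ + simq => /(_ simq).
    (* At level exactly [c], a local maximum would satisfy the condition of [E] vacuously, so only
       the second alternative survives. *)
    have [[_ pmax]|[U [Up noU simU]]] := reg p Fp.
      exfalso; apply: nEp; split; first by split => //; rewrite /= cp.
      near=> q => Fq cq; have : f q <= f p by move: Fq; near: q; exact: pmax.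
      by rewrite -cp leNgt cq.
    have [q0 [Uq0 Fq0 cq0 nsim0]] : exists q, [/\ U q, F q, c < f q & ~ sim q].
      apply: contrapT => no; apply: nEp; split; first by split => //; rewrite /= cp.
      apply: filterS Up => q Uq Fq cq; apply: contrapT => nq.
      by apply: no; exists q.
    (* Points of [U] above [c] are joined to each other above [c], so the single unjoined point [q0]
       makes all of them unjoined. *)
    have nsimU q : U q -> F q -> c < f q -> ~ sim q.
      move=> Uq Fq cq simq; apply: nsim0.
      have [||t pt tq] := simU q0 q Uq0 Uq Fq0 Fq; rewrite -?cp //.
      by apply: sim_trans tq simq; rewrite cp.
    (* A member [q] of [E] close to [p] has no higher feasible neighbour, which would be both joined
       and not joined to [x]; so [q] would be a local maximum inside [U]. *)
    near=> q => Fcq [_ Eq].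
    have [Fq cq] := Fcq.
    have Uq : nbhs q U by near: q; exact: nbhs_interior.
    apply: (noU q (nbhs_singleton Uq)); split => //.
    near=> q' => Fq'; rewrite leNgt; apply/negP => qq'.
    have cq' : c < f q' by exact: le_lt_trans qq'.
    apply: (nsimU q') => //; first by near: q'; exact: Uq.
    by move: Fq' cq'; near: q'; exact: Eq.
  - by split => //; exact: ltW.
have [s Ss ts] := sup_gt S_ne tc.
exact: (tno s ts).
Unshelve. all: by end_near. Qed.

End MinimaxSeparation.

(** * Pushing along a direction *)

Section Pushing.
Context {R : realType} {V : normedModType R}.
Implicit Types (F A : set V) (f : V -> R) (p q z d : V).

Lemma near_segment A z d : nbhs z A ->
  exists2 t : R, 0 < t & \forall p \near z, forall s, 0 <= s <= t -> A (p + s *: d).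
Proof.
move=> /nbhs_ballP[e /= e0 zA].
(* Half of [e] is kept for moving the base point; the divisor [1 + |d|] also covers [d = 0]. *)
have d0 : 0 < 1 + `|d| by rewrite ltr_wpDr.
exists (e / 2 / (1 + `|d|)); first by rewrite !divr_gt0.
apply/nbhs_ballP; exists (e / 2); first by rewrite /= divr_gt0.
move=> p /=; rewrite -ball_normE /= => zp s /andP[s0 st]; apply: zA.
rewrite -ball_normE /= opprD addrA (le_lt_trans (ler_normB _ _)) //.
have : `|s *: d| <= e / 2.
  rewrite normrZ ger0_norm // (le_trans (ler_wpM2r _ st)) //.
  rewrite -mulrA; apply: ler_piMr; first by rewrite divr_ge0 // ltW.
  by rewrite ler_pdivrMl // mulr1 lerDr.
by lra.
Qed.

Lemma connected_component_segment A p q :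
  (forall s : R, 0 <= s <= 1 -> A (p + s *: (q - p))) -> connected_component A p q.
Proof.
move=> pqA; exists ((fun s : R => p + s *: (q - p)) @` `[0, 1]); last first.
  by exists 1; rewrite ?scale1r ?subrKC //= in_itv /= ler01 lexx.
split.
- by exists 0; rewrite ?scale0r ?addr0 //= in_itv /= ler01 lexx.
- by move=> _ [s /= s01 <-]; apply: pqA; rewrite in_itv in s01.
- apply: connected_continuous_connected; first exact: segment_connected.
  apply: continuous_subspaceT => s.
  by apply: cvgD; [exact: cvg_cst|apply: cvgZr_tmp; exact: cvg_id].
Qed.

Lemma ball_segment z p q (r s : R) : 0 <= s <= 1 ->
  ball z r p -> ball z r q -> ball z r (p + s *: (q - p)).
Proof.
rewrite -ball_normE /= => /andP[s0 s1] zp zq.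
have -> : z - (p + s *: (q - p)) = (1 - s) *: (z - p) + s *: (z - q).
  rewrite scalerBl scale1r -addrA [- _ + _]addrC -scalerBr opprD addrA.
  by congr (_ + _); rewrite -scalerN !opprB [z - q + _]addrC addrA subrK.
rewrite (le_lt_trans (ler_normD _ _)) // !normrZ (ger0_norm s0) ger0_norm ?subr_ge0 //.
have [->|sN1] := eqVneq s 1; first by rewrite subrr mul0r add0r mul1r.
have s1' : 0 < 1 - s by rewrite subr_gt0 lt_neqAle sN1.
rewrite [ltRHS](_ : _ = (1 - s) * r + s * r); last by rewrite -mulrDl subrK mul1r.
by rewrite ltr_leD // ?ltr_pM2l // ler_wpM2l // ltW.
Qed.

Lemma cvg_translate f z d : continuous f -> f (p + d) @[p --> z] --> f (z + d).
Proof.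
move=> f_cont; apply: (@cvg_comp _ _ _ (fun p => p + d) f _ (nbhs (z + d))).
  by apply: cvgD; [exact: cvg_id|exact: cvg_cst].
exact: f_cont.
Qed.

(* The second clause, where [p] need not lie in [F], makes a whole ball around
   [z] land in [F]; that is what joins two nearby points once pushed. *)
Definition pushable F z d := exists2 t0 : R, 0 < t0 &
  (\forall p \near z, F p -> forall s, 0 <= s <= t0 -> F (p + s *: d)) /\
  (forall s, 0 < s <= t0 -> \forall p \near z, F (p + s *: d)).

(** The path runs from [p] up to [p + t *: d], across the translated ball, which is convex, and down
    to [q]. *)
Lemma pushed_connected A z d (r t : R) p q : 0 < t ->
  (forall s, 0 <= s <= t -> A (p + s *: d)) ->
  (forall s, 0 <= s <= t -> A (q + s *: d)) ->
  (forall p', ball z r p' -> A (p' + t *: d)) ->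
  ball z r p -> ball z r q -> connected_component A p q.
Proof.
move=> t0 pA qA bA zp zq.
have up p' : (forall s, 0 <= s <= t -> A (p' + s *: d)) ->
    connected_component A p' (p' + t *: d).
  move=> p'A; apply: connected_component_segment => s /andP[s0 s1].
  rewrite [_ + t *: d]addrC addrK scalerA; apply: p'A.
  by rewrite mulr_ge0 ?(ltW t0) //= ler_piMl // ltW.
apply: (@connected_component_trans _ _ (p + t *: d)); first exact: up.
apply: (@connected_component_trans _ _ (q + t *: d)); last first.
  by apply: connected_component_sym; exact: up.
apply: connected_component_segment => s s01.
rewrite [p + _]addrC addrKA -addrA addrC.
by apply: bA; exact: ball_segment.
Qed.

Section Level.
Variables (F : set V) (f : V -> R).
Hypothesis f_cont : continuous f.

(** [f] may decrease along [d], but by continuity a short push from near [z] stays at level at least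
    [t]. *)
Lemma pushable_locally_connected z d (t : R) :
  F z -> pushable F z d -> t < f z ->
  \forall q \near z, F q -> connected_component (superlevel F f t) z q.
Proof.
move=> Fz [t0 t0_gt0 [push_in push_near]] tz.
have Lz : nbhs z [set q | t <= f q].
  by apply: filterS (continuous_near_gt f_cont tz) => q /ltW.
have [t1 t1_gt0 push_level] := near_segment d Lz.
pose u := Num.min t0 t1.
have u_gt0 : 0 < u by rewrite lt_min t0_gt0.
have u0 : 0 < u <= t0 by rewrite u_gt0 ge_min lexx.
have /nbhs_ballP[r /= r0 rP] : \forall q \near z,
    [/\ F q -> forall s, 0 <= s <= t0 -> F (q + s *: d),
        F (q + u *: d) & forall s, 0 <= s <= t1 -> t <= f (q + s *: d)].
  by near=> q; split; near: q; [exact: push_in|exact: push_near|].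
have stay q : F q -> ball z r q ->
    forall s, 0 <= s <= u -> superlevel F f t (q + s *: d).
  move=> Fq /rP[qF _ qt] s /andP[s0]; rewrite le_min => /andP[st0 st1].
  by split; [apply: qF|apply: qt]; rewrite ?s0.
apply/nbhs_ballP; exists r => // q zq Fq.
have zz : ball z r z by exact: ballxx.
apply: (@pushed_connected _ z d r u) => //; [exact: stay..|].
move=> p /rP[_ Fp pt]; split => //; apply: pt.
by rewrite ltW //= ge_min lexx orbT.
Unshelve. all: by end_near. Qed.

(** On the two legs along [d] the values only grow, and on the crossing leg they exceed a level
    [m > f z]; so the whole path stays strictly above [f z]. A tiny push also beats any candidate
    local maximum near [z]. *)
Lemma pushable_climbing_regular z d (t1 : R) :
  F z -> pushable F z d -> 0 < t1 ->
  (\forall p \near z, forall s, 0 < s <= t1 -> f p < f (p + s *: d)) ->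
  exists U, [/\ nbhs z U, forall q, U q -> ~ local_max_on F f q &
    forall q q', U q -> U q' -> F q -> F q' -> f z < f q -> f z < f q' ->
      exists2 t, f z < t & connected_component (superlevel F f t) q q'].
Proof.
move=> Fz [t0 t0_gt0 [push_in push_near]] t1_gt0 climb.
pose u := Num.min t0 t1.
have u_gt0 : 0 < u by rewrite lt_min t0_gt0.
have u0 : 0 < u <= t0 by rewrite u_gt0 ge_min lexx.
have zu : f z < f (z + u *: d).
  by apply: (nbhs_singleton climb); rewrite u_gt0 ge_min lexx orbT.
have [zm mu] := midf_lt zu; set m := (f z + _) / 2 in zm mu.
have push_level : \forall p \near z, m < f (p + u *: d).
  exact: (cvgr_gt (f (z + u *: d)) (@cvg_translate f z (u *: d) f_cont) _ mu).
have /nbhs_ballP[r /= r0 rP] : \forall q \near z,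
    [/\ F q -> forall s, 0 <= s <= t0 -> F (q + s *: d),
        F (q + u *: d), forall s, 0 < s <= t1 -> f q < f (q + s *: d) &
        m < f (q + u *: d)].
  by near=> q; split; near: q; [exact: push_in|exact: push_near| |].
exists (ball z r); split; first exact: nbhsx_ballx.
- move=> q /rP[qF _ qc _] [Fq qmax].
  have [t2 t2_gt0 /nbhs_singleton stay] := near_segment d qmax.
  pose w := Num.min u t2.
  have w_gt0 : 0 < w by rewrite lt_min u_gt0.
  have : f (q + w *: d) <= f q.
    apply: stay; first by rewrite ltW //= ge_min lexx orbT.
    apply: qF => //; rewrite ltW //=.
    by rewrite (@le_trans _ _ u) // ge_min lexx.
  rewrite leNgt qc // w_gt0 /= (@le_trans _ _ u) // ge_min lexx ?orbT //.
- move=> q q' zq zq' Fq Fq' fq fq'.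
  exists (Num.min m (Num.min (f q) (f q'))); first by rewrite !lt_min zm fq.
  have stay p : F p -> ball z r p -> Num.min m (Num.min (f q) (f q')) <= f p ->
      forall s, 0 <= s <= u ->
      superlevel F f (Num.min m (Num.min (f q) (f q'))) (p + s *: d).
    move=> Fp /rP[pF _ pc _] mp s /andP[s0]; rewrite le_min => /andP[st0 st1].
    split; first by apply: pF; rewrite ?s0.
    move: s0; rewrite le_eqVlt => /predU1P[<-|s0]; first by rewrite scale0r addr0.
    by rewrite /= (le_trans mp) // ltW // pc // s0.
  apply: (@pushed_connected _ z d r u) => //.
  + by apply: stay; rewrite // !ge_min lexx !orbT.
  + by apply: stay; rewrite // !ge_min lexx !orbT.
  + by move=> p /rP[_ Fp _ mp]; split => //=; rewrite ge_min ltW.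
Unshelve. all: by end_near. Qed.

End Level.

End Pushing.

(** * Differentials and convexity *)

Section Calculus.
Context {R : realType} {V : normedModType R}.
Implicit Types (h : V -> R) (x v p d : V).

Lemma diff_gt_near h x v (c : R) : differentiable h x -> c < 'd h x v ->
  \forall t \near 0^'+, h x + t * c < h (x + t *: v).
Proof.
move=> dh; rewrite -deriveE // => cD.
have D_right : (fun t : R => t^-1 *: ((h \o shift x) (t *: v) - h x)) @ 0^'+ --> 'D_v h x.
  by apply: cvg_dnbhs_at_right; exact: diff_derivable.
have {}D_right := cvgr_gt _ D_right _ cD.
near=> t.
have t0 : 0 < t by [].
have : c < t^-1 *: ((h \o shift x) (t *: v) - h x).
  by near: t; exact: D_right.
rewrite /= /GRing.scale /= ltr_pdivlMl // ltrBrDl [t *: v + x]addrC //.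
Unshelve. all: by end_near. Qed.

Lemma is_derive_along h p d (s : R) : differentiable h (p + s *: d) ->
  is_derive s (1 : R) (fun r : R => h (p + r *: d)) ('d h (p + s *: d) d).
Proof.
move=> dh; rewrite -deriveE //.
have e : (fun t : R => t^-1 *: (((fun r : R => h (p + r *: d)) \o shift s) (t *: 1) - h (p + s *: d)))
   = (fun t : R => t^-1 *: ((h \o shift (p + s *: d)) (t *: d) - h (p + s *: d))).
  apply/funext => t /=; congr (_ *: (h _ - _)).
  by rewrite [t *: 1]mulr1 scalerDl addrCA.
by split; rewrite ?/derivable ?/derive e //; exact: diff_derivable.
Qed.

Lemma diff_lt0_decreasing h p d (t : R) : 0 < t -> (forall x, differentiable h x) ->
  (forall s, 0 <= s <= t -> 'd h (p + s *: d) d < 0) -> h (p + t *: d) < h p.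
Proof.
move=> t0 dh dneg.
have [| |c] := @MVT R (fun r => h (p + r *: d)) (fun r => 'd h (p + r *: d) d) 0 t t0.
- by move=> s _; exact: is_derive_along.
- apply: continuous_subspaceT => s.
  have := is_derive_along (dh (p + s *: d)) => ?.
  exact/differentiable_continuous/derivable1_diffP/ex_derive.
- rewrite in_itv /= => /andP[c0 ct].
  rewrite scale0r addr0 subr0 => e; rewrite -subr_lt0 e nmulr_rlt0 //.
  by apply: dneg; rewrite !ltW.
Qed.

End Calculus.

Section ConvexPlane.
Context {R : realType}.
Implicit Types (h : 'rV[R]_2 -> R) (x y v p d : 'rV[R]_2).

Lemma convex_on_segment h x y (t : R) : convex_on_plane h -> 0 <= t <= 1 ->
  h (x + t *: (y - x)) <= (1 - t) * h x + t * h y.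
Proof.
move=> hc /andP[t0 t1].
(* The weight [t] goes to the first point of a convex combination, hence the order [y], [x]. *)
have := hc (Itv01 t0 t1) y x.
rewrite !inE => /(_ Logic.I Logic.I).
rewrite convRE /=; congr (h _ <= _); last by rewrite addrC.
rewrite [LHS](_ : _ = t *: y + (1 - t) *: x) //.
by rewrite scalerBl scale1r scalerBr addrCA.
Qed.

(** If [h y] were below the tangent, [h] would exceed the chord from [x] to [y] at small [t]. *)
Lemma convex_tangent h x y : convex_on_plane h -> differentiable h x ->
  h x + 'd h x (y - x) <= h y.
Proof.
move=> hc dh; rewrite leNgt; apply/negP; rewrite -ltrBlDl => lt.
near (0 : R)^'+ => t.
have t0 : 0 < t by [].
have t1 : t < 1 by [].
have : h x + t * (h y - h x) < h (x + t *: (y - x)).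
  by near: t; exact: diff_gt_near.
have t01 : 0 <= t <= 1 by rewrite !ltW.
have := convex_on_segment x y hc t01.
lra.
Unshelve. all: by end_near. Qed.

Definition dot (u v : 'rV[R]_2) : R := \sum_j u 0 j * v 0 j.

Lemma diff_dot h x v : differentiable h x -> 'd h x v = dot (grad h x) v.
Proof.
move=> dh; rewrite [in LHS](row_sum_delta v) linear_sum; apply: eq_bigr => j _.
by rewrite linearZ -deriveE // mxE mulrC.
Qed.

Lemma dot_continuous v : continuous (dot^~ v).
Proof.
have -> : dot^~ v = (fun u => u 0 0 * v 0 0 + u 0 1 * v 0 1).
  by apply/funext => u; rewrite /dot big_ord_recl big_ord1 (_ : lift ord0 ord0 = 1) //; exact: val_inj.
move=> u; have c j := @coord_continuous R 1 2 0 j u.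
exact: (cvgD (cvgMr_tmp (c 0)) (cvgMr_tmp (c 1))).
Qed.

Lemma dotDl u u' v : dot (u + u') v = dot u v + dot u' v.
Proof. by rewrite -big_split; apply: eq_bigr => j _; rewrite mxE mulrDl. Qed.

Lemma dotZl (a : R) u v : dot (a *: u) v = a * dot u v.
Proof. by rewrite mulr_sumr; apply: eq_bigr => j _; rewrite mxE mulrA. Qed.

Lemma dot_suml (I : Type) (r : seq I) (P : pred I) (u : I -> 'rV[R]_2) v :
  dot (\sum_(i <- r | P i) u i) v = \sum_(i <- r | P i) dot (u i) v.
Proof.
rewrite /dot; under eq_bigr do rewrite summxE mulr_suml.
exact: exchange_big.
Qed.

Lemma concave_tangent (f : 'rV[R]_2 -> R) x y : concave_on_plane f -> differentiable f x ->
  f y <= f x + dot (grad f x) (y - x).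
Proof.
move=> fc df; have dNf : differentiable (- f) x by exact: differentiableN.
have := convex_tangent y fc dNf.
by rewrite diffN // -diff_dot //= -[(- _ : _ -> _) _]/(- _); lra.
Qed.

(** One step [t] that raises [f] at [z] raises it at all nearby [p] by continuity; concavity along
    the segment then gives the increase at every shorter step, uniformly in [p]. *)
Lemma concave_climb (f : 'rV[R]_2 -> R) z d : concave_on_plane f -> continuous f ->
  differentiable f z -> 0 < dot (grad f z) d ->
  exists2 t : R, 0 < t & \forall p \near z, forall s, 0 < s <= t -> f p < f (p + s *: d).
Proof.
move=> fc f_cont df fd.
have [t t0 ft] : exists2 t, 0 < t & f z < f (z + t *: d).
  have /(diff_gt_near df) : 0 < 'd f z d by rewrite diff_dot.
  move=> fnear; near (0 : R)^'+ => t; exists t => //.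
  by rewrite -[ltLHS]addr0 -(mulr0 t); near: t.
exists t => //.
have shift_cvg : f (p + t *: d) - f p @[p --> z] --> f (z + t *: d) - f z.
  exact: (cvgB (@cvg_translate R 'rV[R]_2 f z (t *: d) f_cont) (@f_cont z)).
have := cvgr_gt _ shift_cvg 0; rewrite subr_gt0 => /(_ _ ft).
apply: filterS => p; rewrite subr_gt0 => pt s /andP[s0 st].
have st01 : 0 <= s / t <= 1 by rewrite divr_ge0 ?(ltW s0) ?(ltW t0) //= ler_pdivrMr // mul1r.
have := convex_on_segment p (p + t *: d) fc st01.
rewrite [p + t *: d]addrC addrK scalerA divfK ?gt_eqF // [t *: d + p]addrC.
have st0 : 0 < s / t by rewrite divr_gt0.
nra.
Unshelve. all: by end_near. Qed.

End ConvexPlane.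

(** * Differentiability of real analytic functions *)

Lemma dot_linear (R : realType) (u : 'rV[R]_2) : linear (dot u).
Proof.
move=> a v w; rewrite -[a *: dot u v]mulrC /dot mulr_suml -big_split.
by apply: eq_bigr => j _; rewrite !mxE mulrDr mulrA mulrAC.
Qed.

HB.instance Definition _ (R : realType) (u : 'rV[R]_2) :=
  GRing.isLinear.Build R 'rV[R]_2 R _ (dot u) (dot_linear u).

Lemma quadratic_remainder_differentiable (R : realType) (V : normedModType R)
    (f : V -> R) (l : {linear V -> R}) (p : V) (M r : R) :
  continuous l -> 0 < r -> 0 <= M ->
  (forall v, `|v| <= r -> `|f (p + v) - (f p + l v)| <= M * `|v| ^+ 2) ->
  differentiable f p.
Proof.
move=> l_cont r0 M0 fP.
have exp : f \o shift p = cst (f p) + l +o_ 0 id.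
  apply/eqaddoP => _/posnumP[e].
  near=> v; rewrite /= -![(_ + _ : _ -> _) _]/(_ + _) -![(- _ : _ -> _) _]/(- _) /cst /=.
  have vr : `|v| <= r by near: v; exact: nbhs0_le.
  rewrite [v + p]addrC (le_trans (fP v vr)) //.
  rewrite expr2 mulrA ler_wpM2r //.
  (* The divisor [M + 1] covers [M = 0]. *)
  have ve : `|v| <= e%:num / (M + 1).
    by near: v; apply: nbhs0_le; rewrite divr_gt0 // ltr_wpDl.
  rewrite (le_trans (ler_wpM2l M0 ve)) // mulrCA ler_piMr // ler_pdivrMr ?mul1r ?lerDl //.
  by rewrite ltr_wpDl.
by apply/diff_locallyP; rewrite (diff_unique l_cont exp).
Unshelve. all: by end_near. Qed.

Section Analytic.
Context {R : realType}.
Implicit Types (f : 'rV[R]_2 -> R) (c : nat * nat -> R) (p v w : 'rV[R]_2).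

Lemma dotC v w : dot v w = dot w v.
Proof. by apply: eq_bigr => j _; rewrite mulrC. Qed.

Lemma coord_le_norm v j : `|v 0 j| <= `|v|.
Proof.
rewrite [leRHS]/Num.norm /= mx_normrE.
exact: (le_bigmax _ (fun ij : 'I_1 * 'I_2 => `|v ij.1 ij.2|) (0, j)).
Qed.

(** Flattening the double sum to one list lets it be split by total degree. *)
Definition square_indices (n : nat) : seq (nat * nat) :=
  [seq (j, k) | j <- iota 0 n, k <- iota 0 n].

Lemma square_indices_uniq n : uniq (square_indices n).
Proof. by apply: allpairs_uniq; rewrite ?iota_uniq // => -[? ?] [? ?] _ _ /= [-> ->]. Qed.

Lemma mem_square_indices n j k : ((j, k) \in square_indices n) = (j < n)%N && (k < n)%N.
Proof.
apply/allpairsP/andP => [[[j' k'] /= []]|[jn kn]].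
  by rewrite !mem_iota !add0n /= => ? ? [-> ->].
by exists (j, k); rewrite !mem_iota.
Qed.

Lemma sum_square_indices n (F : nat * nat -> R) :
  \sum_(j < n) \sum_(k < n) F (val j, val k) = \sum_(jk <- square_indices n) F jk.
Proof.
have iE : iota 0 n = index_iota 0 n by rewrite /index_iota subn0.
rewrite big_allpairs iE big_mkord; apply: eq_bigr => j _.
by rewrite big_mkord.
Qed.

Lemma sum_low_terms c v n : (1 < n)%N ->
  \sum_(jk <- square_indices n | (jk.1 + jk.2 <= 1)%N) power_term c v jk =
  c (0, 0)%N + c (1, 0)%N * v 0 0 + c (0, 1)%N * v 0 1.
Proof.
move=> n1; rewrite -big_filter (perm_big [:: (0, 0); (1, 0); (0, 1)]%N); last first.
  apply: uniq_perm => //; first by rewrite filter_uniq // square_indices_uniq.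
  case=> j k; rewrite mem_filter mem_square_indices /= !inE !xpair_eqE.
  by case: j => [|[|j]]; case: k => [|[|k]] //; rewrite !(ltnW n1) ?n1.
by rewrite !big_cons big_nil /power_term /= !expr0 !expr1 !mulr1 addr0 addrA.
Qed.

(** A monomial of degree at least 2, compared with its value at the corner [(r, r)], gains a factor
    [|v| / r <= 1] per degree, of which two are kept. *)
Lemma power_term_le c v (r : R) (jk : nat * nat) : 0 < r -> `|v| <= r ->
  (1 < jk.1 + jk.2)%N ->
  `|power_term c v jk| <= `|power_term c (const_mx r) jk| * (`|v| / r) ^+ 2.
Proof.
case: jk => j k r0 vr jk1; rewrite /power_term /= !mxE !normrM !normrX (gtr0_norm r0).
rewrite -!mulrA; apply: ler_wpM2l => //; rewrite mulrA -exprD.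
have vj i : `|v 0 i| <= `|v| := coord_le_norm v i.
apply: (@le_trans _ _ (`|v| ^+ (j + k))).
  by rewrite exprD ler_pM ?exprn_ge0 // lerXn2r ?nnegrE.
rewrite -{1}(divfK (lt0r_neq0 r0) `|v|) exprMn mulrC ler_pM2l ?exprn_gt0 //.
apply: ler_wiXn2l => //; first by rewrite divr_ge0 // ltW.
by rewrite ler_pdivrMr // mul1r.
Qed.

Lemma summable_sum_square_le (F : nat * nat -> R) :
  summable [set: nat * nat] (fun jk => (F jk)%:E) ->
  exists M : R, forall n, \sum_(jk <- square_indices n) `|F jk| <= M.
Proof.
move=> sF; have sfin : (\esum_(jk in [set: nat * nat]) `|(F jk)%:E|)%E \is a fin_num.
  by rewrite -summableE.
exists (fine (\esum_(jk in [set: nat * nat]) `|(F jk)%:E|)%E) => n.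
rewrite -lee_fin fineK // -sumEFin.
apply: esum_ge; exists [set` square_indices n]; first by split => //; exact: finite_seq.
by rewrite -fsbig_seq // square_indices_uniq.
Qed.

(** The terms of degree at most 1 form the affine part; absolute convergence at the corner [(s, s)]
    bounds all the others by a multiple of [|v| ^+ 2]. *)
Lemma real_analytic_remainder f p : real_analytic f ->
  exists (u : 'rV[R]_2) (M r : R), [/\ 0 < r, 0 <= M &
    forall v, `|v| <= r -> `|f (p + v) - (f p + dot u v)| <= M * `|v| ^+ 2].
Proof.
move=> /(_ p) [c [r [r0 fP]]].
(* The corner [(s, s)] has sup norm [s < r], so the series converges absolutely there. *)
pose s := r / 2; have s0 : 0 < s by rewrite divr_gt0.
have sr : s < r by rewrite ltr_pdivrMr // ltr_pMr // ltr1n.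
have s_norm : `|const_mx s : 'rV[R]_2| < r.
  rewrite [ltLHS]/Num.norm /= mx_normrE; apply/bigmax_ltP; split => // ij _.
  by rewrite mxE gtr0_norm.
have [M MP] := summable_sum_square_le (fP _ s_norm).1.
have M0 : 0 <= M by apply: le_trans (MP 0%N); rewrite sumr_ge0.
have est v : `|v| <= s ->
    `|f (p + v) - (c (0, 0)%N + c (1, 0)%N * v 0 0 + c (0, 1)%N * v 0 1)|
      <= M * (`|v| / s) ^+ 2.
  move=> vs; set L := c (0, 0)%N + _ + _.
  have [_ fv] := fP v (le_lt_trans vs sr).
  have fL : `|\sum_(j < n) \sum_(k < n) power_term c v (val j, val k) - L| @[n --> \oo]
      --> `|f (p + v) - L|.
    exact: cvg_norm (cvgB fv (cvg_cst L)).
  rewrite -(cvg_lim _ fL) //; apply: limr_le; first by apply/cvg_ex; eexists; exact: fL.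
  near=> n; have n1 : (1 < n)%N by near: n; exact: nbhs_infty_gt.
  rewrite /= (sum_square_indices n (power_term c v)).
  rewrite (bigID (fun jk => (jk.1 + jk.2 <= 1)%N)) /= sum_low_terms // -/L.
  rewrite addrAC subrr add0r (le_trans (ler_norm_sum _ _ _)) //.
  apply: (@le_trans _ _ (\sum_(jk <- square_indices n)
     `|power_term c (const_mx s) jk| * (`|v| / s) ^+ 2)).
    rewrite big_mkcond /=; apply: ler_sum => jk _; case: ifPn => [|_].
      by rewrite -ltnNge; exact: power_term_le.
    by rewrite mulr_ge0 // exprn_ge0 // divr_ge0 // ltW.
  by rewrite -mulr_suml ler_wpM2r // exprn_ge0 // divr_ge0 // ltW.
(* The estimate at [v = 0] has right-hand side 0. *)
have fp : f p = c (0, 0)%N.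
  apply/eqP; rewrite -subr_eq0 -normr_le0.
  have := est 0; rewrite normr0 mul0r expr0n mulr0 !mxE !mulr0 !addr0.
  by apply; exact: ltW.
exists (\row_j if j == 0 then c (1, 0)%N else c (0, 1)%N), (M / s ^+ 2), s.
split => // [|v /est]; first by rewrite divr_ge0 // exprn_ge0 // ltW.
rewrite fp /dot big_ord_recl big_ord1 !mxE /= (_ : lift ord0 ord0 = 1) ?addrA; last exact: val_inj.
by rewrite exprMn exprVn mulrA mulrAC.
Unshelve. all: by end_near. Qed.

Lemma real_analytic_differentiable f p : real_analytic f -> differentiable f p.
Proof.
move=> /(real_analytic_remainder p) [u [M [r [r0 M0 fP]]]].
have u_cont : continuous (dot u).
  have -> : dot u = dot^~ u by apply/funext => v; exact: dotC.
  exact: dot_continuous.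
exact: (@quadratic_remainder_differentiable R 'rV[R]_2 f (dot u) p M r).
Qed.

End Analytic.

(** * Constraints *)

Section ConstraintPushing.
Context {R : realType} {V : normedModType R}.
Implicit Types (h : V -> R) (z d p : V).

Lemma interior_pushable (F : set V) z d : nbhs z F -> pushable F z d.
Proof.
move=> /(near_segment d)[t t0 tP]; exists t => //; split.
  by apply: filterS tP => p pF _.
move=> s /andP[s0 st]; apply: filterS tP => p pF.
by apply: pF; rewrite (ltW s0).
Qed.

(** If [h z < 0], continuity suffices. If [h z = 0], the derivative along [d] is negative on a
    neighbourhood, so [h] decreases along all short nearby segments. Asking this of all small [t]
    lets finitely many constraints share one [t]. *)
Lemma constraint_pushable_near h z d :
  (forall x, differentiable h x) -> continuous (fun p => 'd h p d) ->
  h z <= 0 -> (h z = 0 -> 'd h z d < 0) ->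
  \forall t \near (0 : R)^'+,
    (\forall p \near z, h p <= 0 -> forall s, 0 <= s <= t -> h (p + s *: d) <= 0) /\
    (forall s, 0 < s <= t -> \forall p \near z, h (p + s *: d) <= 0).
Proof.
move=> dh dh_cont; have h_cont : continuous h by move=> x; exact: differentiable_continuous.
rewrite le_eqVlt => /predU1P[hz /(_ hz) dneg|hz _].
  have dneg_near : nbhs z [set x | 'd h x d < 0] by exact: cvgr_lt (@dh_cont z) _ dneg.
  have [t0 t0_gt0 t0P] := near_segment d dneg_near.
  near=> t; have tt0 : t <= t0 by near: t; exact: nbhs_right_le.
  split.
    apply: filterS t0P => p pneg hp s /andP[]; rewrite le_eqVlt => /predU1P[<- _|s0 st].
      by rewrite scale0r addr0.
    rewrite (le_trans _ hp) // ltW // diff_lt0_decreasing // => s' /andP[s'0 s's].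
    by apply: pneg; rewrite s'0 (le_trans s's) // (le_trans st).
  move=> s /andP[s0 st].
  have hs : h (z + s *: d) < 0.
    rewrite -hz; apply: diff_lt0_decreasing => // s' /andP[s'0 s's].
    by apply: (nbhs_singleton t0P); rewrite s'0 (le_trans s's) // (le_trans st).
  by apply: filterS (cvgr_lt _ (@cvg_translate _ _ h z (s *: d) h_cont) _ hs) => p /ltW.
have hz_near : nbhs z [set x | h x <= 0].
  by apply: filterS (cvgr_lt _ (@h_cont z) _ hz) => p /ltW.
have [t0 t0_gt0 t0P] := near_segment d hz_near.
near=> t; have tt0 : t <= t0 by near: t; exact: nbhs_right_le.
split=> [|s /andP[s0 st]]; apply: filterS t0P => p pP.
  by move=> _ s /andP[s0 st]; apply: pP; rewrite s0 (le_trans st).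
by apply: pP; rewrite (ltW s0) (le_trans st).
Unshelve. all: by end_near. Qed.

Lemma constraints_pushable (I : finType) (g : I -> V -> R) z d :
  (forall i x, differentiable (g i) x) ->
  (forall i, continuous (fun p => 'd (g i) p d)) ->
  (forall i, g i z <= 0) -> (forall i, g i z = 0 -> 'd (g i) z d < 0) ->
  pushable [set x | forall i, g i x <= 0] z d.
Proof.
move=> dg dg_cont gz gneg.
have : \forall t \near (0 : R)^'+, 0 < t /\ forall i,
    (\forall p \near z, g i p <= 0 -> forall s, 0 <= s <= t -> g i (p + s *: d) <= 0) /\
    (forall s, 0 < s <= t -> \forall p \near z, g i (p + s *: d) <= 0).
  apply: filterI; first exact: nbhs_right_gt.
  exact: (filter_forall _ (fun i =>
    constraint_pushable_near (dg i) (@dg_cont i) (gz i) (@gneg i))).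
move=> /filter_ex[t [t0 tP]]; exists t => //; split.
  have : \forall p \near z, forall i,
      g i p <= 0 -> forall s, 0 <= s <= t -> g i (p + s *: d) <= 0.
    exact: (filter_forall _ (fun i => (tP i).1)).
  by apply: filterS => p pP gp s st i; exact: pP.
by move=> s st; exact: (filter_forall _ (fun i => (tP i).2 s st)).
Qed.

End ConstraintPushing.

(** * Linearly independent gradients *)

Section DotDuality.
Context {R : realType}.
Implicit Types (b d v w : 'rV[R]_2).

Lemma dotE v w : dot v w = (v *m w^T) 0 0.
Proof. by rewrite mxE; apply: eq_bigr => j _; rewrite mxE. Qed.

Lemma dot_self_eq0 v : (dot v v == 0) = (v == 0).
Proof.
apply/eqP/eqP => [|->]; last by rewrite /dot big1 // => j _; rewrite mxE mul0r.
move=> /eqP; rewrite psumr_eq0 => [/allP v0|j _]; last by rewrite -expr2 sqr_ge0.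
apply/rowP => j; rewrite mxE.
by have := v0 j (mem_index_enum j); rewrite /= mulf_eq0 orbb => /eqP.
Qed.

Lemma dot_self_gt0 v : v != 0 -> 0 < dot v v.
Proof.
move=> v0; rewrite lt_neqAle eq_sym dot_self_eq0 v0 /=.
by apply: sumr_ge0 => j _; rewrite -expr2 sqr_ge0.
Qed.

(** The matrix with the vectors of [X] as rows has a right inverse [B], and [B] applied to the
    column of targets is a solution. *)
Lemma free_nth_dot_solve (X : seq 'rV[R]_2) (t : nat -> R) : free X ->
  exists d, forall k, (k < size X)%N -> dot X`_k d = t k.
Proof.
move=> /(@freeP _ _ _ (in_tuple X)) X_free.
pose A : 'M[R]_(size X, 2) := \matrix_i X`_i.
have /row_freeP[B AB] : row_free A.
  apply: inj_row_free => v vA; apply/rowP => k; rewrite mxE; apply: X_free.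
  rewrite -[RHS]vA mulmx_sum_row; apply: eq_bigr => i _.
  by rewrite rowK.
exists (B *m \col_k t (val k))^T => k kX.
rewrite dotE trmxK mulmxA.
have -> : X`_k = row (Ordinal kX) A by rewrite rowK.
by rewrite -row_mul AB -row_mul mul1mx !mxE.
Qed.

Lemma free_dot_solve (T : eqType) (S : seq T) (u : T -> 'rV[R]_2) (t : T -> R) :
  free (map u S) -> exists d, forall i, i \in S -> dot (u i) d = t i.
Proof.
case: S => [_|i0 S /free_nth_dot_solve]; first by exists 0.
move=> /(_ (fun k => t (nth i0 (i0 :: S) k)))[d dP]; exists d => i iS.
have := dP (index i (i0 :: S)); rewrite size_map index_mem => /(_ iS).
by rewrite (nth_map i0) ?index_mem // nth_index.
Qed.

Lemma span_lincomb (T : eqType) (S : seq T) (u : T -> 'rV[R]_2) b : uniq S ->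
  b \in <<map u S>>%VS -> exists k : T -> R, b = \sum_(i <- S) k i *: u i.
Proof.
elim: S b => [|i S IH] b /=; first by rewrite span_nil memv0 => _ /eqP ->; exists (fun=> 0); rewrite big_nil.
move=> /andP[iS Su]; rewrite span_cons => /memv_addP[_ /vlineP[a ->] [v /(IH _ Su)[k ->] ->]].
exists (fun j => if j == i then a else k j); rewrite big_cons eqxx; congr (_ + _).
rewrite !big_seq; apply: eq_bigr => j jS.
by case: eqP => // ji; rewrite -ji jS in iS.
Qed.

(* Farkas' lemma by linear algebra: solve [dot (u i) d = - t i], with [t i] large
   at an index of negative multiplier. *)
Lemma ascent_direction (T : eqType) (S : seq T) (u : T -> 'rV[R]_2) b :
  uniq S -> free (map u S) ->
  ~ (exists mu : T -> R, (forall i, 0 <= mu i) /\ b = \sum_(i <- S) mu i *: u i) ->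
  exists d, 0 < dot b d /\ forall i, i \in S -> dot (u i) d < 0.
Proof.
move=> Su S_free noKKT.
have [bS|bS] := boolP (b \in <<map u S>>%VS); last first.
  (* Outside the span, [b] joins the free family as the index [None] and its product with [d] can be
     prescribed too. *)
  pose u' (o : option T) := if o is Some i then u i else b.
  have u'_free : free (map u' (None :: map Some S)).
    by rewrite /= -map_comp (eq_map (g := u)) // free_cons bS.
  have [d dP] := free_dot_solve (fun o => if o is Some _ then -1 else 1) u'_free.
  exists d; split; first by rewrite (dP None) ?inE.
  by move=> i iS; rewrite (dP (Some i)) ?inE ?map_f //= ltrN10.
have [k bk] := span_lincomb Su bS.
(* Without a negative coefficient, the truncations [max 0 (k i)] would be the excluded
   multipliers. *)
have [i0 i0S ki0] : exists2 i, i \in S & k i < 0.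
  apply: contrapT => nok; apply: noKKT; exists (fun i => Num.max 0 (k i)); split.
    by move=> i; rewrite le_max lexx.
  rewrite bk !big_seq; apply: eq_bigr => i iS; rewrite max_r // leNgt.
  by apply/negP => ki; apply: nok; exists i.
pose s := \sum_(i <- rem i0 S) k i.
(* With this [t] the index [i0] contributes [1 + |s|] to [dot b d], which outweighs the contribution
   [- s] of the others. *)
pose t := (1 + `|s|) / - k i0.
have t0 : 0 < t by rewrite divr_gt0 ?oppr_gt0 // ltr_pwDl.
have [d dP] := free_dot_solve (fun i => if i == i0 then - t else -1) S_free.
exists d; split; last by move=> i /dP ->; case: ifP => _; rewrite ?oppr_lt0 ?t0 ?ltrN10.
have -> : dot b d = - t * k i0 - s.
  rewrite bk dot_suml (perm_big _ (perm_to_rem i0S)) big_cons /= dotZl dP // eqxx mulrC.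
  congr (_ + _); rewrite -sumrN big_seq [in RHS]big_seq; apply: eq_bigr => i iS.
  rewrite dotZl dP ?(mem_rem iS) //; move: iS; rewrite mem_rem_uniq // inE => /andP[/negPf -> _].
  by rewrite mulrN1.
rewrite mulNr -mulrN divfK ?oppr_eq0 ?lt_eqF //.
by have := ler_norm s; lra.
Qed.

Lemma free_size_le2 (X : seq 'rV[R]_2) : free X -> (size X <= 2)%N.
Proof.
rewrite /free => /eqP <-; rewrite (leq_trans (dimvS (subvf _))) // dimvf.
by rewrite /dim /= mul1n.
Qed.

(** With [e1], [e2] the dual basis of [a1], [a2], every [v] equals
    [dot a1 v *: e1 + dot a2 v *: e2]. *)
Lemma free_pair_coercive a1 a2 : free [:: a1; a2] ->
  exists2 C : R, 0 < C & forall v, `|v| <= C * (`|dot a1 v| + `|dot a2 v|).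
Proof.
move=> a_free; pose u (c : bool) : 'rV[R]_2 := if c then a1 else a2.
have u_free : free [seq u c | c <- [:: true; false]] by [].
have solve t := @free_dot_solve bool [:: true; false] u t u_free.
have [e1 e1P] := solve (fun c => c%:R).
have [e2 e2P] := solve (fun c => (~~ c)%:R).
have [] := (e1P true isT, e1P false isT); rewrite /= => e11 e12.
have [] := (e2P true isT, e2P false isT); rewrite /= => e21 e22.
have C0 : 0 < `|e1| + `|e2| + 1 by rewrite ltr_wpDl ?addr_ge0.
exists (`|e1| + `|e2| + 1) => [//|v].
have v_exp : v = dot a1 v *: e1 + dot a2 v *: e2.
  apply/eqP; rewrite -subr_eq0 -dot_self_eq0; set w := v - _.
  have w1 : dot a1 w = 0.
    by rewrite linearB linearD !linearZ /= e11 e21 /GRing.scale /= mulr1 mulr0 addr0 subrr.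
  have w2 : dot a2 w = 0.
    by rewrite linearB linearD !linearZ /= e12 e22 /GRing.scale /= mulr1 mulr0 add0r subrr.
  (* Two independent vectors span the plane, so [w], orthogonal to both, is orthogonal to itself. *)
  have : w \in <<[seq u c | c <- [:: true; false]]>>%VS.
    suff -> : (<<[seq u c | c <- [:: true; false]]>> = fullv)%VS by rewrite memvf.
    apply/eqP; rewrite eqEdim subvf /= (eqP u_free) dimvf.
    by rewrite /dim /= mul1n.
  move=> /(@span_lincomb bool [:: true; false] u w isT)[k wk].
  by rewrite {1}wk dot_suml big1 // => -[] _; rewrite dotZl /= ?w1 ?w2 mulr0.
rewrite {1}v_exp (le_trans (ler_normD _ _)) // !normrZ.
have := normr_ge0 e1; have := normr_ge0 e2.
have := normr_ge0 (dot a1 v); have := normr_ge0 (dot a2 v).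
by nra.
Qed.

End DotDuality.

(** * Local maxima at two active constraints *)

Lemma diff_near_le (R : realType) (V : normedModType R) (h : V -> R) (x : V) (e : R) :
  differentiable h x -> 0 < e ->
  \forall y \near x, 'd h x (y - x) <= h y - h x + e * `|y - x|.
Proof.
move=> /diff_locally /eqaddoP dh e0.
have {dh} : \forall v \near (0 : V), `|h (v + x) - (h x + 'd h x v)| <= e * `|v| by exact: dh.
rewrite (near_shift x); apply: filterS => y.
by rewrite /= sub0r subrK distrC => /(le_trans (ler_norm _)); lra.
Qed.

Section TwoActive.
Context {R : realType}.
Implicit Types (x y : 'rV[R]_2).

(** Feasibility bounds both products [s] and [t] above by [e * N], where [N] is the distance to [x].
    If [f y > f x], then [m1 * s + m2 * t > 0] bounds them below as well, and coercivity makes [N]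
    at most half of itself. *)
Lemma two_active_local_max (f g1 g2 : 'rV[R]_2 -> R) x (m1 m2 : R) :
  differentiable g1 x -> differentiable g2 x -> g1 x = 0 -> g2 x = 0 ->
  free [:: grad g1 x; grad g2 x] -> 0 < m1 -> 0 < m2 ->
  (forall y, f y <= f x + (m1 * dot (grad g1 x) (y - x) + m2 * dot (grad g2 x) (y - x))) ->
  \forall y \near x, g1 y <= 0 -> g2 y <= 0 -> f y <= f x.
Proof.
move=> d1 d2 g1x g2x /free_pair_coercive[C C0 CP] m1_gt0 m2_gt0 fle.
pose K := C * (2 + m2 / m1 + m1 / m2).
have q1 : 0 < m2 / m1 by rewrite divr_gt0.
have q2 : 0 < m1 / m2 by rewrite divr_gt0.
have K0 : 0 < K by rewrite mulr_gt0 // !addr_gt0.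
(* Chosen so that [K * e] is one half. *)
pose e := (2 * K)^-1; have e0 : 0 < e by rewrite invr_gt0 mulr_gt0.
have near1 := diff_near_le d1 e0.
have near2 := diff_near_le d2 e0.
near=> y => g1y g2y.
have s_le : dot (grad g1 x) (y - x) <= e * `|y - x|.
  rewrite -diff_dot //; apply: (@le_trans _ _ (g1 y - g1 x + e * `|y - x|)).
    by near: y; exact: near1.
  by rewrite g1x subr0 gerDr.
have t_le : dot (grad g2 x) (y - x) <= e * `|y - x|.
  rewrite -diff_dot //; apply: (@le_trans _ _ (g2 y - g2 x + e * `|y - x|)).
    by near: y; exact: near2.
  by rewrite g2x subr0 gerDr.
have := fle y; have := CP (y - x); move: s_le t_le.
set s := dot _ _; set t := dot _ _; set N := `|y - x| => s_le t_le N_le fy.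
rewrite (le_trans fy) // gerDl leNgt; apply/negP => st0.
have N0 : 0 <= N by exact: normr_ge0.
have s_ge : - (m2 / m1 * (e * N)) < s.
  rewrite -(ltr_pM2l m1_gt0) [ltLHS](_ : _ = - (m2 * (e * N))); last by field; rewrite lt0r_neq0.
  by have := ler_wpM2l (ltW m2_gt0) t_le; lra.
have t_ge : - (m1 / m2 * (e * N)) < t.
  rewrite -(ltr_pM2l m2_gt0) [ltLHS](_ : _ = - (m1 * (e * N))); last by field; rewrite lt0r_neq0.
  by have := ler_wpM2l (ltW m1_gt0) s_le; lra.
have s_abs : `|s| <= (1 + m2 / m1) * (e * N).
  rewrite ler_norml; apply/andP; split; nra.
have t_abs : `|t| <= (1 + m1 / m2) * (e * N).
  rewrite ler_norml; apply/andP; split; nra.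
have N_half : N <= N / 2.
  rewrite (le_trans N_le) // (le_trans (ler_wpM2l (ltW C0) (lerD s_abs t_abs))) //.
  rewrite [leLHS](_ : _ = K * e * N); last by rewrite /K; lra.
  by rewrite /e invfM mulrCA mulfV ?lt0r_neq0 // mulr1 mulrC.
have N00 : N = 0 by lra.
(* At [N = 0] the bounds become [0 < s] and [s <= 0]. *)
by move: s_ge s_le; rewrite N00 !mulr0 oppr0; lra.
Unshelve. all: by end_near. Qed.

End TwoActive.

(** * KKT points *)

Section Problem.
Context {R : realType} {m : nat}.
Variables (f : 'rV[R]_2 -> R) (g : 'I_m -> 'rV[R]_2 -> R).
Hypotheses (f_concave : concave_on_plane f) (f_diff : forall x, differentiable f x).
Hypothesis g_C2 : forall i, twice_continuously_differentiable (g i).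
Implicit Types (x y d : 'rV[R]_2).

Local Notation F := (feasible g).

Definition active x : seq 'I_m := [seq i <- enum 'I_m | g i x == 0].

Lemma mem_active x i : (i \in active x) = (g i x == 0).
Proof. by rewrite mem_filter mem_enum andbT. Qed.

Lemma active_uniq x : uniq (active x).
Proof. by rewrite filter_uniq // enum_uniq. Qed.

Let g_diff i x : differentiable (g i) x.
Proof. by have [] := g_C2 i. Qed.

Lemma constraint_diff_continuous i d : continuous (fun x => 'd (g i) x d).
Proof.
have -> : (fun x => 'd (g i) x d) = dot^~ d \o grad (g i).
  by apply/funext => x; rewrite diff_dot.
move=> x; have [_ /(_ x) gdiff _] := g_C2 i.
have := differentiable_continuous gdiff => g_cont.
exact: (continuous_comp g_cont (@dot_continuous _ _ _)).
Qed.

Lemma feasible_closed : closed F.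
Proof.
have -> : F = \bigcap_(i in setT) (g i @^-1` [set z | z <= 0]).
  by apply/seteqP; split => [x Fx i _|x Fx i]; [exact: Fx|exact: Fx].
apply: closed_bigI => i _; apply: preimage_closed; last exact: closed_le.
by move=> x _; exact: differentiable_continuous.
Qed.

(** A small move along a nonzero gradient would make [g i] positive at a point that is still
    feasible. *)
Lemma interior_active_grad0 x i : nbhs x F -> g i x = 0 -> grad (g i) x = 0.
Proof.
move=> xF gx; apply/eqP; apply: contrapT => /negP grad0.
have : 0 < 'd (g i) x (grad (g i) x) by rewrite diff_dot // dot_self_gt0.
move=> /(diff_gt_near (@g_diff i x)) up.
have [t0 t0_gt0 /nbhs_singleton stay] := near_segment (grad (g i) x) xF.
near (0 : R)^'+ => t.
have : g i x + t * 0 < g i (x + t *: grad (g i) x) by near: t; exact: up.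
rewrite gx add0r mulr0 ltNge => /negP; apply; apply: (stay t).
by apply/andP; split; near: t; [exact: nbhs_right_ge|exact: nbhs_right_le].
Unshelve. all: by end_near. Qed.

Lemma concave_critical_global x : F x -> grad f x = 0 -> global_maximizer f g x.
Proof.
move=> Fx fx; split => // y _.
have := concave_tangent y f_concave (@f_diff x).
by rewrite fx /dot big1 ?addr0 // => j _; rewrite mxE mul0r.
Qed.

Lemma sum_active x (mu : 'I_m -> R) : (forall i, mu i * g i x = 0) ->
  \sum_i mu i *: grad (g i) x = \sum_(i <- active x) mu i *: grad (g i) x.
Proof.
move=> mug; rewrite big_filter big_enum_cond /= [RHS]big_mkcond; apply: eq_bigr => i _.
case: eqP => // /eqP gi; have /eqP := mug i.
by rewrite mulf_eq0 (negPf gi) orbF => /eqP ->; rewrite scale0r.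
Qed.

Hypothesis F_LICQ : forall x, boundary F x -> LICQ g x.

Lemma interior_or_LICQ x : F x -> nbhs x F \/ LICQ g x.
Proof.
move=> Fx; have [xF|xF] := pselect (nbhs x F); first by left.
by right; apply: F_LICQ; split => //; exact: subset_closure.
Qed.

(** LICQ allows the derivatives of all active constraints along [d] to be set to -1; in the interior
    any direction works. *)
Lemma feasible_pushable x : F x -> exists d, pushable F x d.
Proof.
move=> Fx; have [xF|x_LICQ] := interior_or_LICQ Fx; first by exists 0; exact: interior_pushable.
have [d dP] := @free_dot_solve R _ (active x) (fun i => grad (g i) x) (fun=> -1) x_LICQ.
exists d; apply: constraints_pushable => //; first by move=> i; exact: constraint_diff_continuous.
by move=> i gi; rewrite diff_dot // dP ?ltrN10 // mem_active gi.
Qed.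

Lemma not_KKT_ascent x : F x -> ~ KKT_point f g x ->
  exists d, pushable F x d /\ 0 < dot (grad f x) d.
Proof.
move=> Fx nKKT.
have f0 : grad f x != 0.
  apply/eqP => fx; apply: nKKT; split => //; exists (fun=> 0); split => // [|i].
    by rewrite big1 // => i _; rewrite scale0r.
  by rewrite mul0r.
have [xF|x_LICQ] := interior_or_LICQ Fx.
  by exists (grad f x); split; [exact: interior_pushable|exact: dot_self_gt0].
have [|d [fd gd]] := @ascent_direction R _ (active x) (fun i => grad (g i) x)
  (grad f x) (active_uniq x) x_LICQ.
  move=> [mu [mu0 fmu]]; apply: nKKT; split => //.
  (* Extending by 0 off the active set gives complementary slackness. *)
  pose nu i := if g i x == 0 then mu i else 0.
  have nug i : nu i * g i x = 0.
    by rewrite /nu; case: eqP => [->|_]; rewrite ?mulr0 ?mul0r.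
  exists nu; split => //; first by move=> i; rewrite /nu; case: ifP.
  rewrite sum_active // fmu big_seq [RHS]big_seq; apply: eq_bigr => i.
  by rewrite mem_active /nu => ->.
exists d; split => //; apply: constraints_pushable => //.
  by move=> i; exact: constraint_diff_continuous.
by move=> i gi; rewrite diff_dot // gd // mem_active gi.
Qed.

Hypothesis invex : boundary_invex f g.

(** If [g i] is convex, its tangent inequality confines feasible points to a half-plane where the
    tangent bound on [f] is at most [f x]. Otherwise [x] is a KKT point of the reversed problem; a
    multiplier [lam >= 0] would give [(mu + lam) *: grad (g i) x = 0] and so [grad f x = 0], which
    leaves only the local maximum. *)
Lemma single_multiplier_local_max x i (mu : R) : F x -> grad f x != 0 ->
  0 < mu -> g i x = 0 -> grad f x = mu *: grad (g i) x -> local_maximum f g x.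
Proof.
move=> Fx f0 mu0 gi fx; have [gi_conv|gi_nconv] := pselect (convex_on_plane (g i)).
  split => //; near=> y => Fy.
  have := concave_tangent y f_concave (@f_diff x).
  have := convex_tangent y gi_conv (@g_diff i x).
  rewrite diff_dot // gi add0r fx dotZl => gy /le_trans; apply.
  by rewrite gerDl pmulr_rle0 // (le_trans gy) //; exact: Fy.
have [||[lam [lam0 fl]]|//] := invex gi_nconv (x := x); first last.
- move: fl; rewrite /equality_KKT_multiplier fx => /eqP.
  rewrite -subr_eq0 -scalerBl scaler_eq0 opprK gt_eqF ?ltr_pwDl //= => /eqP g0.
  by rewrite fx g0 scaler0 eqxx in f0.
- by [].
- by split; [rewrite gi|exists mu; rewrite gi mulr0 ltW].
Unshelve. all: by end_near. Qed.

Lemma KKT_local_maximum x : KKT_point f g x -> local_maximum f g x.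
Proof.
move=> [Fx [mu [mu_ge0 fmu mug]]].
have [fx|f0] := eqVneq (grad f x) 0.
  have [_ fmax] := concave_critical_global Fx fx.
  by split => //; near=> y; exact: fmax.
have gi0 i : mu i != 0 -> g i x = 0.
  by move=> mui; have /eqP := mug i; rewrite mulf_eq0 (negPf mui) => /eqP.
have mu_gt0 i : mu i != 0 -> 0 < mu i by move=> mui; rewrite lt_neqAle eq_sym mui mu_ge0.
(* In the interior all active gradients vanish, hence so would [grad f x]. *)
have [xF|x_LICQ] := interior_or_LICQ Fx.
  exfalso; move/eqP: f0; apply; rewrite fmu big1 // => i _.
  have [->|/gi0 gi] := eqVneq (mu i) 0; first by rewrite scale0r.
  by rewrite (interior_active_grad0 xF gi) scaler0.
have [i mui] : exists i, mu i != 0.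
  apply: contrapT => no; move/eqP: f0; apply; rewrite fmu big1 // => i _.
  have [->|mui] := eqVneq (mu i) 0; first by rewrite scale0r.
  by exfalso; apply: no; exists i.
have [[j [ji muj]]|only_i] := pselect (exists j, j != i /\ mu j != 0); last first.
  apply: (@single_multiplier_local_max x i (mu i)) => //; [exact: mu_gt0|exact: gi0|].
  rewrite fmu (bigD1 i) //= big1 ?addr0 // => j ji.
  have [->|muj] := eqVneq (mu j) 0; first by rewrite scale0r.
  by exfalso; apply: only_i; exists j.
(* Independence in the plane allows at most two active constraints, so [i] and [j] are all of
   them. *)
have ij_active : perm_eq (active x) [:: i; j].
  have ij_uniq : uniq [:: i; j] by rewrite /= inE eq_sym ji.
  have ij_sub : {subset [:: i; j] <= active x}.
    by move=> k; rewrite !inE mem_active => /orP[] /eqP ->; rewrite gi0.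
  have size2 : (size (active x) <= size [:: i; j])%N.
    by have := free_size_le2 x_LICQ; rewrite size_map.
  rewrite perm_sym; apply: uniq_perm => //; first exact: active_uniq.
  by have [] := uniq_min_size ij_uniq ij_sub size2.
have ij_free : free [:: grad (g i) x; grad (g j) x].
  by rewrite -(perm_free (perm_map (fun k => grad (g k) x) ij_active)).
have near_x : \forall y \near x, g i y <= 0 -> g j y <= 0 -> f y <= f x.
  apply: (@two_active_local_max R f (g i) (g j) x (mu i) (mu j)) => //; auto.
  move=> y; have := concave_tangent y f_concave (@f_diff x).
  rewrite {1}fmu sum_active // (perm_big _ ij_active) /= !big_cons big_nil addr0.
  by rewrite dotDl !dotZl.
split => //; near=> y => Fy.
have /(_ (Fy i) (Fy j)) : g i y <= 0 -> g j y <= 0 -> f y <= f x by near: y; exact: near_x.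
by [].
Unshelve. all: by end_near. Qed.

End Problem.

Unset Implicit Arguments.

Theorem theorem6 (R : realType) (m : nat)
    (f : 'rV[R]_2 -> R) (g : 'I_m -> 'rV[R]_2 -> R)
    (f_concave : concave_on_plane f)
    (f_analytic : real_analytic f)
    (g_C2 : forall i : 'I_m, twice_continuously_differentiable (g i))
    (F_connected : connected (feasible g))
    (F_bounded : bounded_set (feasible g))
    (F_LICQ : forall x : 'rV[R]_2, boundary (feasible g) x -> LICQ g x) :
  boundary_invex f g -> KT_invex f g.
Proof.
move=> invex x x_KKT.
have f_diff z : differentiable f z by exact: real_analytic_differentiable.
have f_cont : continuous f by move=> z; exact: differentiable_continuous.
have F_closed := feasible_closed g_C2.
split; first by case: x_KKT.
apply: (@local_max_on_global R 'rV[R]_2 (feasible g) f _ F_closed F_connected f_cont).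
- exact: bounded_closed_compact.
- move=> p t Fp tp; have [d dP] := feasible_pushable g_C2 F_LICQ Fp.
  exact: (pushable_locally_connected f_cont Fp dP tp).
- move=> p Fp; have [p_KKT|p_nKKT] := pselect (KKT_point f g p).
    by left; exact: (KKT_local_maximum f_concave f_diff g_C2 F_LICQ invex p_KKT).
  right; have [d [dP fd]] := not_KKT_ascent g_C2 F_LICQ Fp p_nKKT.
  have [t t0 climb] := concave_climb f_concave f_cont (f_diff p) fd.
  exact: (pushable_climbing_regular f_cont Fp dP t0 climb).
- exact: (KKT_local_maximum f_concave f_diff g_C2 F_LICQ invex x_KKT).
Qed.
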